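(* Let $x>0$ be real, $b$ complex and $z\neq 0$ complex. Then $$\sum_{n=1}^{\infty}\mu(n)\left(E_{nx,b}\left(-z^{nx}\right)-\frac{1}{\Gamma(b)}\right)=\frac{2z^{2x}}{\Gamma(b+2x)}-\frac{z^{x}}{\Gamma(b+x)} .$$
   Context: The Mittag-Leffler function is $E_{a,b}(z)=\sum_{k=0}^{\infty}\frac{z^{k}}{\Gamma(b+ak)}$ for $\operatorname{Re}(a)>0$, with $1/\Gamma$ the entire reciprocal Gamma function. $\mu$ is the Möbius function. Powers are $z^{c}=e^{c\log z}$ with the same fixed value of $\log z$ throughout, and $-z^{nx}$ means $-(z^{nx})$. *)

(* Defs.v *)
From Stdlib Require Import Reals ZArith.
From Coquelicot Require Import Coquelicot.
From mathcomp Require Import all_boot.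

Set Implicit Arguments.
Unset Strict Implicit.
Unset Printing Implicit Defensive.

Local Open Scope R_scope.

Definition moebius (n : nat) : Z :=
  if (0 < n)%N && all (fun p => logn p n <= 1)%N (primes n)
  then ((-1) ^ Z.of_nat (size (primes n)))%Z
  else 0%Z.

(* Limits and sums of complex sequences are taken componentwise.  Like Lim_seq
   and Series, these operators are total, and meaningful only for sequences
   (series) that converge. *)
Definition Clim_seq (u : nat -> C) : C :=
  (real (Lim_seq (fun n => Re (u n))), real (Lim_seq (fun n => Im (u n)))).

Definition CSeries (u : nat -> C) : C :=
  (Series (fun n => Re (u n)), Series (fun n => Im (u n))).

Definition Cexp (z : C) : C :=
  (exp (Re z) * cos (Im z), exp (Re z) * sin (Im z)).

(* The power z^c = exp (c log z), as a function of the chosen value l of log z,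
   that is, of an l such that Cexp l = z. *)
Definition Cpow_log (l c : C) : C := Cexp (c * l)%C.

(* The entire function 1/Gamma, by the Euler-Gauss limit
     1/Gamma(s) = lim_n  s (s+1) ... (s+n) / (n! n^s),
   which converges for every complex s, and to 0 at s = 0, -1, -2, ... *)
Definition rGamma (s : C) : C :=
  Clim_seq (fun n =>
    ((\big[Cmult/RtoC 1]_(0 <= k < n.+1) (s + INR k))
       / (INR n`! * Cpow_log (ln (INR n)) s))%C).

(* E_{a,b}(z); the series converges for Re a > 0. *)
Definition mittag_leffler (a b z : C) : C :=
  CSeries (fun k => (Cpow z k * rGamma (b + a * INR k))%C).

(* Main.v *)
Require Import Defs.
From Stdlib Require Import Reals ZArith Lra Lia.
From Coquelicot Require Import Coquelicot.
From HB Require Import structures.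
From mathcomp Require Import all_boot.

Local Open Scope R_scope.

(** Put [w = exp (x log z)] and [c m = w^m / Gamma (b + m x)].  Since
    [z^(n x) = w^n], the [n]-th bracket is [sum_(k >= 1) (-1)^k c (n k)], so,
    collecting the terms with [n k = m], the left-hand side is
    [sum_(m >= 1) c m * a m] with [a m = sum_(n | m) mu n (-1)^(m / n)].  As
    [(-1)^k = 2 [k even] - 1], the identity [sum_(n | m) mu n = [m = 1]] gives
    [a m = 2 [m = 2] - [m = 1]] ([sum_moebius_sign]), and only
    [2 c 2 - c 1] survives.

    The rearrangement is justified by the bound [|c m| <= K / 4^m]
    ([ml_coef_le]).  Cut the [n]-th inner series at [n k <= N]: the finite double
    sum over [n <= N] rearranges exactly ([sum_moebius_multiples]), while each of
    the [N] tails only involves [c m] with [m > N] and is at most [K / 4^N]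
    ([alternating_tail]).  The total error [N K / 4^N] tends to 0
    ([moebius_alternating_series]).  All of this is done with real sequences and
    then applied to the real and imaginary parts of [c].

    For the bound on [c], let [P n s] be the Euler-Gauss approximation of
    [1 / Gamma s].  It suffices to bound [P n s] for all large [n], because
    [Lim_seq] of an eventually bounded sequence obeys the same bound.  A
    telescoping estimate bounds [P n s] uniformly in [n] on bounded sets
    ([rGamma_approx_le]); the functional equation [P n (s + 1)] ~ [P n s / s]
    then gives, on each horizontal line, decay faster than any exponential in
    [Re s] ([rGamma_approx_decay]). *)

(** * Divisor sums of the Moebius function *)

HB.instance Definition _ := Monoid.isComLaw.Build R 0 Rplus
  (fun x y z => esym (Rplus_assoc x y z)) Rplus_comm Rplus_0_l.

HB.instance Definition _ := Monoid.isMulLaw.Build R 0 Rmult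
  Rmult_0_l Rmult_0_r.

HB.instance Definition _ := Monoid.isAddLaw.Build R Rmult Rplus
  Rmult_plus_distr_r Rmult_plus_distr_l.

Local Notation mu n := (IZR (moebius n)).

Lemma Rabs_moebius n : Rabs (mu n) <= 1.
Proof.
rewrite -abs_IZR; apply: IZR_le; rewrite /moebius.
case: ifP => // _; elim: (size _) => [//|k IH].
by rewrite Nat2Z.inj_succ Z.pow_succ_r; lia.
Qed.

Lemma moebius_primeM p d : prime p -> (0 < d)%N ->
  moebius (p * d) = if (p %| d)%N then 0%Z else (- moebius d)%Z.
Proof.
move=> p_pr d_gt0; have p_gt0 := prime_gt0 p_pr.
rewrite /moebius muln_gt0 p_gt0 d_gt0 /=.
have memM q : (q \in primes (p * d)) = (q == p) || (q \in primes d).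
  by rewrite primesM // primes_prime // inE.
case: (boolP (p %| d)%N) => [p_dvd | p_ndvd].
  case: ifP => // /allP /(_ p); rewrite memM eqxx => /(_ isT).
  rewrite lognM // logn_prime // eqxx add1n ltnS leqNgt.
  by rewrite logn_gt0 mem_primes p_pr d_gt0 p_dvd.
have p_primes : perm_eq (primes (p * d)) (p :: primes d).
  apply: uniq_perm; first exact: primes_uniq.
    by rewrite /= primes_uniq mem_primes p_pr d_gt0 p_ndvd.
  by move=> q; rewrite memM inE.
have lognp q : q \in primes d -> logn q (p * d) = logn q d.
  move=> q_d; rewrite lognM // logn_prime //.
  by case: eqP q_d => // ->; rewrite mem_primes (negPf p_ndvd) !andbF.
rewrite (perm_all _ p_primes) /=.
rewrite lognM // logn_prime // eqxx.
have /eqP -> : logn p d == 0%N.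
  by rewrite -leqn0 leqNgt logn_gt0 mem_primes (negPf p_ndvd) !andbF.
rewrite /= (@eq_in_all _ _ (fun q => logn q d <= 1)%N); last first.
  by move=> q /lognp ->.
case: ifP => // _; rewrite (perm_size p_primes) [size (_ :: _)]/=.
by rewrite Nat2Z.inj_succ Z.pow_succ_r; lia.
Qed.

Lemma perm_divisors_dvd d m : (0 < m)%N -> (d %| m)%N ->
  perm_eq [seq n <- divisors m | d %| n]%N [seq (d * n)%N | n <- divisors (m %/ d)].
Proof.
move=> m_gt0 d_m; have d_gt0 : (0 < d)%N by exact: dvdn_gt0 d_m.
have q_gt0 : (0 < m %/ d)%N by rewrite divn_gt0 // dvdn_leq.
apply: uniq_perm; first by rewrite filter_uniq ?divisors_uniq.
  rewrite map_inj_uniq ?divisors_uniq // => i j /eqP.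
  by rewrite eqn_pmul2l // => /eqP.
move=> n; rewrite mem_filter -dvdn_divisors //.
apply/andP/mapP => [[/dvdnP [k ->] kd_m]|[k]].
  by exists k; [rewrite -dvdn_divisors // dvdn_divRL | rewrite mulnC].
by rewrite -dvdn_divisors // dvdn_divRL // => k_m ->; rewrite dvdn_mulr ?dvdnn // mulnC.
Qed.

(** For [m > 1] choose a prime [p] dividing [m].  Multiplication by [p] matches
    the divisors of [m] prime to [p], which are also the divisors of [m / p]
    prime to [p], with divisors of opposite [mu]; every divisor left out is a
    multiple of [p^2]. *)
Lemma sum_moebius m : (0 < m)%N ->
  \big[Rplus/0]_(n <- divisors m) mu n = if m == 1%N then 1 else 0.
Proof.
move=> m_gt0; case: eqP => [->|/eqP m_neq1].
  by rewrite (_ : divisors 1 = [:: 1%N]) // big_seq1.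
have m_gt1 : (1 < m)%N by rewrite ltn_neqAle eq_sym m_neq1.
set p := pdiv m; have p_pr : prime p := pdiv_prime m_gt1.
have p_m : (p %| m)%N := pdiv_dvd m.
have p_gt0 := prime_gt0 p_pr.
have q_gt0 : (0 < m %/ p)%N by rewrite divn_gt0 // dvdn_leq.
rewrite (bigID (fun n => p %| n)%N) /= -big_filter.
rewrite (perm_big _ (perm_divisors_dvd p m m_gt0 p_m)) /= big_map.
rewrite (bigID (fun n => p %| n)%N) /= big1_seq ?Rplus_0_l; last first.
  move=> n /andP [p_n]; rewrite -dvdn_divisors // => n_q.
  by rewrite moebius_primeM ?p_n // (dvdn_gt0 _ n_q).
rewrite -big_filter -(big_filter (divisors m)).
have p_ndvd : perm_eq [seq n <- divisors m | ~~ (p %| n)]%N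
                      [seq n <- divisors (m %/ p) | ~~ (p %| n)]%N.
  apply: uniq_perm; rewrite ?filter_uniq ?divisors_uniq // => n.
  rewrite !mem_filter -!dvdn_divisors //; case: (boolP (p %| n)%N) => //= p_n.
  rewrite -{1}(divnK p_m) Gauss_dvdl // coprime_sym prime_coprime //.
rewrite (perm_big _ p_ndvd) /= -big_split /= big1_seq // => n.
rewrite mem_filter -dvdn_divisors // => /andP [_ /andP [p_n n_q]].
rewrite moebius_primeM ?(negPf p_n) ?(dvdn_gt0 _ n_q) // opp_IZR; lra.
Qed.

Lemma pow_m1 k : (-1) ^ k = (if (2 %| k)%N then 2 else 0) - 1.
Proof.
elim: k => [|k IH] /=; first by lra.
by rewrite IH !dvdn2 /=; case: (odd k) => /=; lra.
Qed.

(** By [(-1)^k = 2 [k even] - 1]: the divisors [n] of [m] with [m / n] even are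
    the divisors of [m / 2], so the even part of the sum is an ordinary Moebius
    sum for [m / 2]. *)
Lemma sum_moebius_sign m : (0 < m)%N ->
  \big[Rplus/0]_(n <- divisors m) (mu n * (-1) ^ (m %/ n)) =
    (if m == 2%N then 2 else 0) - (if m == 1%N then 1 else 0).
Proof.
move=> m_gt0; rewrite -(sum_moebius m m_gt0).
rewrite (eq_bigr (fun n => (mu n * (if (2 %| m %/ n)%N then 2 else 0)
   + - 1 * mu n))); last by move=> n _; rewrite pow_m1; lra.
rewrite big_split -big_distrr /=.
set S := \big[_/_]_(i <- _) (_ * _).
suff -> : S = if m == 2%N then 2 else 0 by lra.
rewrite /S (bigID (fun n => 2 %| m %/ n)%N) /= Rplus_comm big1 ?Rplus_0_l; last first.
  by move=> n /negPf ->; lra.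
rewrite (eq_bigr (fun n => mu n * 2)); last by move=> n ->.
rewrite -big_distrl /= -big_filter.
have [m2|m2] := boolP (2 %| m)%N; last first.
  have -> : [seq n <- divisors m | 2 %| m %/ n]%N = [::].
    apply/eqP; rewrite -[_ == _]negbK -has_filter; apply/hasPn => n.
    rewrite -dvdn_divisors // => n_m; apply: contra m2 => h.
    by rewrite -(divnK n_m) dvdn_mulr.
  by case: eqP m2 => [->|] //; rewrite big_nil; lra.
have q_gt0 : (0 < m %/ 2)%N by rewrite divn_gt0 // dvdn_leq.
have even_quot : perm_eq [seq n <- divisors m | 2 %| m %/ n]%N (divisors (m %/ 2)).
  apply: uniq_perm; rewrite ?filter_uniq ?divisors_uniq // => n.
  rewrite mem_filter -!dvdn_divisors // [n %| _ %/ 2]dvdn_divRL //.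
  apply/andP/idP => [[h n_m]|h].
    by rewrite mulnC -dvdn_divRL.
  have n_m : (n %| m)%N by apply: dvdn_trans h; rewrite dvdn_mulr.
  by rewrite dvdn_divRL // mulnC.
rewrite (perm_big _ even_quot) sum_moebius //.
have -> : (m %/ 2 == 1)%N = (m == 2)%N.
  by rewrite -(@eqn_pmul2r 2) // divnK.
by case: eqP => _; lra.
Qed.

(** The terms [(n, k)] with [n k <= N] are grouped by the value [m = n k]. *)
Lemma sum_moebius_multiples (c : nat -> R) N :
  \big[Rplus/0]_(1 <= n < N.+1) (mu n *
     \big[Rplus/0]_(1 <= k < (N %/ n).+1) ((-1) ^ k * c (n * k)%N)) =
  \big[Rplus/0]_(1 <= m < N.+1)
     (c m * ((if m == 2%N then 2 else 0) - (if m == 1%N then 1 else 0))).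
Proof.
transitivity (\big[Rplus/0]_(1 <= n < N.+1) \big[Rplus/0]_(1 <= m < N.+1 | (n %| m)%N)
   (mu n * ((-1) ^ (m %/ n) * c m))).
  apply: eq_big_nat => n /andP [n_gt0 n_N].
  rewrite big_distrr /= -[RHS]big_filter.
  have p : perm_eq [seq m <- index_iota 1 N.+1 | n %| m]%N
                   [seq (n * k)%N | k <- index_iota 1 (N %/ n).+1].
    apply: uniq_perm; first by rewrite filter_uniq ?iota_uniq.
      rewrite map_inj_uniq ?iota_uniq // => i j /eqP.
      by rewrite eqn_pmul2l // => /eqP.
    move=> m; rewrite mem_filter mem_index_iota ltnS.
    apply/and3P/mapP => [[/dvdnP [k ->] h1 h2]|[k]].
      exists k; last by rewrite mulnC.
      rewrite mem_index_iota ltnS leq_divRL // h2 andbT.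
      by case: k h1 {h2}.
    rewrite mem_index_iota ltnS leq_divRL // => /andP [k_gt0 h] ->.
    by rewrite dvdn_mulr // muln_gt0 n_gt0 k_gt0 mulnC.
  rewrite (perm_big _ p) big_map; apply: eq_bigr => k _.
  by rewrite mulKn.
rewrite (exchange_big_dep xpredT) //=.
apply: eq_big_nat => m /andP [m_gt0 m_N].
rewrite -sum_moebius_sign // big_distrr /= -big_filter.
have p : perm_eq [seq n <- index_iota 1 N.+1 | n %| m]%N (divisors m).
  apply: uniq_perm; rewrite ?filter_uniq ?divisors_uniq ?iota_uniq // => n.
  rewrite mem_filter mem_index_iota ltnS -dvdn_divisors //.
  case n_m : (n %| m)%N => //=.
  by rewrite (dvdn_gt0 m_gt0) // (leq_trans (dvdn_leq m_gt0 n_m)).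
by rewrite (perm_big _ p); apply: eq_bigr => n _; lra.
Qed.

(** * Rearranging the double series *)

Lemma sum_f_R0_big (a : nat -> R) n :
  sum_f_R0 a n = \big[Rplus/0]_(0 <= k < n.+1) a k.
Proof.
elim: n => [|n IH]; first by rewrite big_nat1.
by rewrite big_nat_recr //= IH.
Qed.

(** The indices [n k] left out all exceed [N] and are distinct, so the tail is
    dominated by the geometric tail [sum_(m > N) K / 4^m]. *)
Lemma alternating_tail (c : nat -> R) (K : R) n N :
  (forall m, Rabs (c m) <= K * (/ 4) ^ m) -> (0 < n)%N ->
  Rabs (Series (fun k => (-1) ^ k * c (n * k)%N) - c 0%N
        - \big[Rplus/0]_(1 <= k < (N %/ n).+1) ((-1) ^ k * c (n * k)%N))
  <= K * (/ 4) ^ N.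
Proof.
move=> c_le n_gt0; set f := fun k => _ * _.
have K_ge0 : 0 <= K by move: (c_le 0%N) (Rabs_pos (c 0%N)) => /=; lra.
have f_le k m : (m <= n * k)%N -> Rabs (f k) <= K * (/ 4) ^ m.
  move=> m_le; rewrite /f Rabs_mult pow_1_abs Rmult_1_l.
  apply: Rle_trans (c_le _) _; apply: Rmult_le_compat_l => //.
  rewrite -(subnKC m_le).
  rewrite pow_add -[X in _ <= X]Rmult_1_r; apply: Rmult_le_compat_l.
    by apply: pow_le; lra.
  rewrite -(pow1 (n * k - m)); apply: pow_incr; lra.
have quarter : Rabs (/ 4) < 1 by rewrite Rabs_right; lra.
have geom m : is_series (fun j => K * (/ 4) ^ m * (/ 4) ^ j)
                        (K * (/ 4) ^ m * / (1 - / 4)).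
  exact: (is_series_scal_l (K * (/ 4) ^ m) _ _ (is_series_geom _ quarter)).
have ex_f : ex_series f.
  apply: (@ex_series_le _ R_CompleteNormedModule _ (fun j => K * (/ 4) ^ 0 * (/ 4) ^ j)).
    by move=> j; rewrite /= Rmult_1_r; apply: f_le; rewrite leq_pmull.
  by eexists; exact: geom.
(* The j-th omitted index n (q + 1 + j) is at least N + 1 + j. *)
set q := (N %/ n)%N.
have q_lt j : (N.+1 + j <= n * (q.+1 + j))%N.
  rewrite mulnDr leq_add ?leq_pmull //.
  by rewrite mulnC -ltn_divLR.
rewrite (Series_incr_n f q.+1) //; last by apply/ltP.
rewrite sum_f_R0_big big_ltn // {1}/f muln0 pow_O.
have -> : forall x y z, 1 * x + y + z - x - y = z by move=> *; lra.
have tail_le j : 0 <= Rabs (f (q.+1 + j)%coq_nat) <= K * (/ 4) ^ N.+1 * (/ 4) ^ j.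
  split; first exact: Rabs_pos.
  by rewrite Rmult_assoc -pow_add; exact: f_le.
have ex_geom : ex_series (fun j => K * (/ 4) ^ N.+1 * (/ 4) ^ j).
  by eexists; exact: geom.
apply: Rle_trans (Series_Rabs _ _) _.
  apply: (@ex_series_le _ R_CompleteNormedModule _ _ _ ex_geom) => j.
  by rewrite /norm /= /abs /= Rabs_Rabsolu; case: (tail_le j).
apply: Rle_trans (Series_le _ _ tail_le ex_geom) _.
rewrite (is_series_unique _ _ (geom _)) /=.
have := Rmult_le_pos _ _ K_ge0 (pow_le (/ 4) N ltac:(lra)); lra.
Qed.

Lemma Rabs_big_le (s : seq nat) (F : nat -> R) (K : R) :
  (forall n, n \in s -> Rabs (F n) <= K) ->
  Rabs (\big[Rplus/0]_(n <- s) F n) <= INR (size s) * K.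
Proof.
elim: s => [|n s IH] F_le; first by rewrite big_nil Rabs_R0 /=; lra.
rewrite big_cons [size _]/= S_INR; apply: Rle_trans (Rabs_triang _ _) _.
have := F_le n; rewrite inE eqxx => /(_ isT).
have IH' : Rabs (\big[Rplus/0]_(n <- s) F n) <= INR (size s) * K.
  by apply: IH => m m_s; apply: F_le; rewrite inE m_s orbT.
lra.
Qed.

(** Lambert-type inversion: the rate [/ 4] is what makes the sum of the [N] tails,
    at most [N K / 4^N <= K / 2^N], vanish. *)
Lemma moebius_alternating_series (c : nat -> R) (K : R) :
  (forall m, Rabs (c m) <= K * (/ 4) ^ m) ->
  is_series (fun m => mu m.+1 * (Series (fun k => (-1) ^ k * c (m.+1 * k)%N) - c 0%N))
            (2 * c 2%N - c 1%N).
Proof.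
move=> c_le.
have K_ge0 : 0 <= K by move: (c_le 0%N) (Rabs_pos (c 0%N)) => /=; lra.
set a := fun m => _ * _.
have N_le N : INR N <= 2 ^ N.
  elim: N => [|N IH]; first by rewrite /=; lra.
  by rewrite S_INR /=; have := pow_R1_Rle 2 N ltac:(lra); lra.
have partial N : (1 < N)%N -> Rabs (\big[Rplus/0]_(0 <= m < N) a m - (2 * c 2%N - c 1%N))
    <= K * (/ 2) ^ N.
  move=> N_gt1.
  have <- : \big[Rplus/0]_(1 <= m < N.+1)
     (c m * ((if m == 2%N then 2 else 0) - (if m == 1%N then 1 else 0)))
      = 2 * c 2%N - c 1%N.
    rewrite big_ltn ?ltnS 1?ltnW // big_ltn ?ltnS // big_nat big1 /=; first by lra.
    by case=> [|[|[|m]]] //= _; lra.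
  rewrite -sum_moebius_multiples.
  pose tail n := Series (fun k => (-1) ^ k * c (n * k)%N) - c 0%N
        - \big[Rplus/0]_(1 <= k < (N %/ n).+1) ((-1) ^ k * c (n * k)%N).
  have -> : \big[Rplus/0]_(0 <= m < N) a m =
      \big[Rplus/0]_(1 <= n < N.+1) (mu n * tail n) +
      \big[Rplus/0]_(1 <= n < N.+1) (mu n *
        \big[Rplus/0]_(1 <= k < (N %/ n).+1) ((-1) ^ k * c (n * k)%N)).
    rewrite -big_split big_add1 /=; apply: eq_bigr => m _.
    by rewrite /a /tail; lra.
  rewrite (_ : forall x y, x + y - y = x); last by move=> *; lra.
  apply: Rle_trans (Rabs_big_le _ _ (K * (/ 4) ^ N) _) _.
    move=> n; rewrite mem_index_iota => /andP [n_gt0 _].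
    rewrite Rabs_mult -[X in _ <= X]Rmult_1_l.
    apply: Rmult_le_compat; try exact: Rabs_pos; first exact: Rabs_moebius.
    exact: alternating_tail.
  rewrite size_iota subn1 /=.
  have -> : / 4 = / 2 * / 2 by lra.
  rewrite Rpow_mult_distr.
  have half_gt0 : 0 < (/ 2) ^ N by apply: pow_lt; lra.
  have e : 2 ^ N * (/ 2) ^ N = 1 by rewrite -Rpow_mult_distr Rinv_r ?pow1; lra.
  have N_half : INR N * (/ 2) ^ N <= 1.
    by rewrite -e; apply: Rmult_le_compat_r => //; lra.
  have := Rmult_le_compat_l (K * (/ 2) ^ N) _ _ (Rmult_le_pos _ _ K_ge0 (Rlt_le _ _ half_gt0)) N_half.
  lra.
have lim0 : is_lim_seq (fun N => K * (/ 2) ^ N) 0.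
  have half_lt1 : Rabs (/ 2) < 1 by rewrite Rabs_right; lra.
  have := is_lim_seq_scal_l _ K _ (is_lim_seq_geom _ half_lt1).
  by rewrite /= Rmult_0_r.
have sum_nE N : sum_n a N = \big[Rplus/0]_(0 <= m < N.+1) a m.
  elim: N => [|N IH]; first by rewrite sum_O big_nat1.
  by rewrite sum_Sn IH [RHS]big_nat_recr.
have {}partial N : (0 < N)%N ->
    Rabs (sum_n a N - (2 * c 2%N - c 1%N)) <= K * (/ 2) ^ N.+1.
  by move=> N_gt0; rewrite sum_nE; apply: partial.
have lim_err (s : R) : is_lim_seq
    (fun N => 2 * c 2%N - c 1%N + s * (K * (/ 2) ^ N.+1)) (2 * c 2%N - c 1%N).
  rewrite -[X in is_lim_seq _ (Rbar.Finite X)]Rplus_0_r -(Rmult_0_r s).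
  apply: is_lim_seq_plus'; first exact: is_lim_seq_const.
  apply: (is_lim_seq_scal_l _ s (Rbar.Finite 0)).
  exact/(is_lim_seq_incr_1 (fun N => K * (/ 2) ^ N)).
apply: (is_lim_seq_le_le_loc _ (sum_n a) _ _ _ (lim_err (-1)) (lim_err 1)).
exists 1%N => N /leP N_gt0; move: (partial N N_gt0) => /Rabs_le_between; lra.
Qed.

(** * Modulus of complex exponentials *)

Lemma CexpD u v : Cexp (u + v)%C = (Cexp u * Cexp v)%C.
Proof.
case: u v => [a b] [c d]; rewrite /Cexp /Cmult /=.
by rewrite exp_plus cos_plus sin_plus; congr (_, _); ring.
Qed.

Lemma Cmod_Cexp u : Cmod (Cexp u) = exp (Re u).
Proof.
rewrite /Cmod /Cexp /=.
have cs := sin2_cos2 (Im u); rewrite /Rsqr in cs.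
rewrite (_ : _ + _ = exp (Re u) * exp (Re u) * (sin (Im u) * sin (Im u) + cos (Im u) * cos (Im u))); last by ring.
by rewrite cs Rmult_1_r sqrt_square //; apply/Rlt_le/exp_pos.
Qed.

Lemma im_le_Cmod u : Rabs (Im u) <= Cmod u.
Proof. exact: Rle_trans (Rmax_r _ _) (Rmax_Cmod u). Qed.

Lemma Cmod_le_abs u : Cmod u <= Rabs (Re u) + Rabs (Im u).
Proof.
have -> : u = (RtoC (Re u) + Ci * RtoC (Im u))%C.
  by case: u => a b; rewrite /Cplus /Cmult /=; congr (_, _); ring.
rewrite /= /Rdiv !(Rmult_0_l, Rmult_0_r, Rmult_1_l, Rplus_0_l, Rplus_0_r, Rminus_0_r).
apply: Rle_trans (Cmod_triangle _ _) _; rewrite Cmod_mult !Cmod_R.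
have -> : Cmod Ci = 1 by rewrite /Cmod /= (_ : _ + _ = 1) ?sqrt_1 //; ring.
lra.
Qed.

Lemma exp_le x y : x <= y -> exp x <= exp y.
Proof. by case=> [lt|->]; [exact/Rlt_le/exp_increasing | lra]. Qed.

(** From [|1 + u|^2 = 1 + 2 Re u + |u|^2 <= exp (2 Re u + |u|^2)]; keeping [Re u]
    instead of [|u|] in the exponent is what lets the factor [n^s] compensate it
    below. *)
Lemma Cmod_1D u : Cmod (1 + u)%C <= exp (Re u + Cmod u ^ 2 / 2).
Proof.
have h : Cmod (1 + u)%C ^ 2 <= exp (Re u + Cmod u ^ 2 / 2) ^ 2.
  rewrite -[X in _ <= X]/(_ * (_ * 1)) Rmult_1_r -exp_plus.
  have -> : Re u + Cmod u ^ 2 / 2 + (Re u + Cmod u ^ 2 / 2) = 2 * Re u + Cmod u ^ 2 by lra.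
  apply: Rle_trans (exp_ineq1_le _).
  by rewrite !Cmod2_alt; case: u => a b /=; lra.
apply: Rnot_lt_le => lt.
have := exp_pos (Re u + Cmod u ^ 2 / 2); nra.
Qed.

(** * The Euler-Gauss product *)

Definition rGamma_approx (s : C) (n : nat) : C :=
  ((\big[Cmult/RtoC 1]_(0 <= k < n.+1) (s + INR k))
     / (INR n`! * Cpow_log (ln (INR n)) s))%C.

HB.instance Definition _ := Monoid.isComLaw.Build C (RtoC 1) Cmult
  Cmult_assoc Cmult_comm Cmult_1_l.

Lemma Cprod_recr (F : nat -> C) n :
  \big[Cmult/RtoC 1]_(0 <= k < n.+1) F k = (\big[Cmult/RtoC 1]_(0 <= k < n) F k * F n)%C.
Proof. by rewrite big_nat_recr. Qed.

Lemma fact_INR_gt0 n : 0 < INR n`!.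
Proof. by apply: lt_0_INR; apply/ltP; rewrite fact_gt0. Qed.

Lemma INR_gt0 n : (0 < n)%N -> 0 < INR n.
Proof. by move=> n_gt0; apply: lt_0_INR; apply/ltP. Qed.

Lemma Cmod_rGamma_approx s n :
  Cmod (rGamma_approx s n) = 
  Cmod (\big[Cmult/RtoC 1]_(0 <= k < n.+1) (s + INR k)%C) / (INR n`! * exp (Re s * ln (INR n))).
Proof.
have f_gt0 := fact_INR_gt0 n.
have modD : Cmod (INR n`! * Cpow_log (ln (INR n)) s)%C = INR n`! * exp (Re s * ln (INR n)).
  rewrite Cmod_mult Cmod_R Rabs_pos_eq; last lra.
  rewrite Cmod_Cexp; congr (_ * exp _); case: s => a b /=; ring.
rewrite /rGamma_approx Cmod_div ?modD //; apply/Cmod_gt_0; rewrite modD.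
by apply: Rmult_lt_0_compat => //; exact: exp_pos.
Qed.

Lemma ln_succ_bounds n : (0 < n)%N ->
  / INR n.+1 <= ln (INR n.+1) - ln (INR n) <= / INR n.
Proof.
move=> n_gt0; have a := INR_gt0 n n_gt0; have b := INR_gt0 n.+1 isT.
have ln_le y : 0 < y -> ln y <= y - 1.
  by move=> y_gt0; have := exp_ineq1_le (ln y); rewrite exp_ln //; lra.
rewrite -ln_div //; split.
  have := ln_le (INR n / INR n.+1) (Rdiv_lt_0_compat _ _ a b).
  rewrite !ln_div //.
  have -> : INR n / INR n.+1 - 1 = - / INR n.+1 by move: b; rewrite S_INR => b; field; lra.
  lra.
have := ln_le (INR n.+1 / INR n) (Rdiv_lt_0_compat _ _ b a).
have -> : INR n.+1 / INR n - 1 = / INR n by rewrite S_INR; field; lra.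
by [].
Qed.

Lemma rGamma_approxS s n : (0 < n)%N ->
  Cmod (rGamma_approx s n.+1) = Cmod (rGamma_approx s n) *
    (Cmod (1 + s / INR n.+1)%C * exp (- Re s * (ln (INR n.+1) - ln (INR n)))).
Proof.
move=> n_gt0; rewrite !Cmod_rGamma_approx Cprod_recr Cmod_mult.
have N_gt0 := INR_gt0 n.+1 isT; have f_gt0 := fact_INR_gt0 n.
have -> : (s + INR n.+1)%C = (INR n.+1 * (1 + s / INR n.+1))%C.
  have N_neq0 : RtoC (INR n.+1) <> 0 by move/RtoC_inj; lra.
  by move: (INR n.+1) N_neq0 => N N_neq0; field.
rewrite Cmod_mult Cmod_R Rabs_pos_eq; last lra.
rewrite factS mult_INR.
have -> : - Re s * (ln (INR n.+1) - ln (INR n))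
  = Re s * ln (INR n) + - (Re s * ln (INR n.+1)) by ring.
rewrite exp_plus exp_Ropp; field.
have := exp_pos (Re s * ln (INR n)); have := exp_pos (Re s * ln (INR n.+1)).
by repeat split; lra.
Qed.

(** The ratio of consecutive approximations is [|1 + s/(n+1)| (n/(n+1))^(Re s)].
    Its logarithm is at most
    [Re s (1/(n+1) - ln ((n+1)/n)) + |s|^2 / (2 (n+1)^2)], hence at most
    [(|Re s| + |s|^2) (1/n - 1/(n+1))], which telescopes. *)
Lemma rGamma_approx_le s n : (0 < n)%N ->
  Cmod (rGamma_approx s n) <=
  Cmod s * Cmod (s + 1)%C * exp ((Rabs (Re s) + Cmod s ^ 2) * (1 - / INR n)).
Proof.
case: n => // n _; elim: n => [|n IH].
  rewrite Cmod_rGamma_approx Cprod_recr big_nat1 /= Cmod_mult ln_1.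
  by rewrite Rmult_0_r Rinv_1 Rminus_diag_eq // Rmult_0_r exp_0 Rmult_1_r Rdiv_1_r Cplus_0_r; lra.
rewrite rGamma_approxS //.
have [lo hi] := ln_succ_bounds n.+1 isT.
have a_gt0 := INR_gt0 n.+1 isT; have b_gt0 := INR_gt0 n.+2 isT.
set a := INR n.+1 in IH lo hi a_gt0 *; set b := INR n.+2 in lo hi b_gt0 *.
have bE : b = a + 1 by exact: S_INR.
have b_neq0 : RtoC b <> 0 by move/RtoC_inj; lra.
set m2 := Cmod s ^ 2 in IH *.
have m2_ge0 : 0 <= m2 by exact: pow2_ge_0.
have -> : (Rabs (Re s) + m2) * (1 - / b) =
   (Rabs (Re s) + m2) * (1 - / a) + (Rabs (Re s) + m2) * (/ a - / b) by ring.
rewrite exp_plus -[X in _ <= X]Rmult_assoc; apply: Rmult_le_compat; try exact: Cmod_ge_0; last 1 first.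
- apply: Rle_trans (Rmult_le_compat_r _ _ _ _ (Cmod_1D _)) _.
    exact/Rlt_le/exp_pos.
  rewrite -exp_plus.
  have -> : Re (s / b)%C = Re s * / b.
    by case: (s) => u v /=; field; lra.
  rewrite Cmod_div // Cmod_R Rabs_pos_eq; last lra.
  rewrite /Rdiv Rpow_mult_distr -/m2.
  have ab : / a - / b = / a * / b by rewrite bE; field; lra.
  have ab_le : / b ^ 2 * / 2 <= / a - / b.
    have inv_lt : / b <= / a by apply: Rinv_le_contravar; lra.
    have := Rinv_0_lt_compat _ b_gt0; rewrite ab -pow_inv /=; nra.
  apply: exp_le.
  have t1 : Re s * / b - Re s * (ln b - ln a) <= Rabs (Re s) * (/ a - / b).
    have := Rle_abs (Re s); have := Rle_abs (- Re s); rewrite Rabs_Ropp.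
    set u := ln b - ln a in lo hi *; nra.
  have t2 := Rmult_le_compat_l _ _ _ m2_ge0 ab_le.
  rewrite pow_inv; lra.
- apply: Rmult_le_pos; [exact: Cmod_ge_0 | exact/Rlt_le/exp_pos].
- exact: IH.
Qed.

Lemma rGamma_approx_bounded s M n : Cmod s <= M -> (0 < n)%N ->
  Cmod (rGamma_approx s n) <= M * (M + 1) * exp (M + M ^ 2).
Proof.
move=> s_le n_gt0; have s_ge0 := Cmod_ge_0 s.
apply: Rle_trans (rGamma_approx_le s n n_gt0) _.
have s1_ge0 := Cmod_ge_0 (s + 1)%C.
have s1_le : Cmod (s + 1)%C <= M + 1.
  by apply: Rle_trans (Cmod_triangle _ _) _; rewrite Cmod_1; lra.
have n_inv := Rinv_0_lt_compat _ (INR_gt0 n n_gt0).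
have re_ge0 := Rabs_pos (Re s); have re_le := re_le_Cmod s.
apply: Rmult_le_compat.
- exact: Rmult_le_pos.
- exact/Rlt_le/exp_pos.
- exact: Rmult_le_compat.
- apply: exp_le.
  have m2_le : Cmod s ^ 2 <= M ^ 2 by apply: pow_incr; lra.
  have m2_ge0 := pow2_ge_0 (Cmod s).
  nra.
Qed.

Lemma rising_shift (s : C) n :
  (s * \big[Cmult/RtoC 1]_(0 <= k < n.+1) (s + 1 + INR k) =
   \big[Cmult/RtoC 1]_(0 <= k < n.+1) (s + INR k) * (s + INR n.+1))%C.
Proof.
elim: n => [|n IH]; first by rewrite !big_nat1 /=; ring.
rewrite !(Cprod_recr _ n.+1) Cmult_assoc IH (S_INR n.+1) RtoC_plus; ring.
Qed.

(** The ratio is exactly [(s + n + 1) / (s n)], that is, asymptotically [1 / s];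
    the factor 2 absorbs [(s + n + 1) / n] for [n] large. *)
Lemma rGamma_approx_shift s r : 0 < r -> r <= Re s ->
  eventually (fun n => Cmod (rGamma_approx (s + 1)%C n) <= 2 / r * Cmod (rGamma_approx s n)).
Proof.
move=> r_gt0 r_le.
have [N N_le] := INR_unbounded (Cmod (s + 1)%C).
exists N.+1 => n /leP N_n; have n_gt0 := INR_gt0 n (leq_ltn_trans (leq0n N) N_n).
have n_ge : Cmod (s + 1)%C <= INR n.
  by apply: Rle_trans (Rlt_le _ _ N_le) _; apply/le_INR/leP/ltnW.
have s_ge : r <= Cmod s.
  by have := re_le_Cmod s; have := Rle_abs (Re s); lra.
have f_gt0 := fact_INR_gt0 n; have e_gt0 := exp_pos (Re s * ln (INR n)).
rewrite !Cmod_rGamma_approx.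
have -> : Re (s + 1)%C = Re s + 1 by case: (s).
rewrite Rmult_plus_distr_r Rmult_1_l exp_plus exp_ln //.
set P := Cmod _; set Q := Cmod _.
have PQ : Cmod s * P <= Q * (2 * INR n).
  rewrite /P /Q -Cmod_mult rising_shift Cmod_mult.
  apply: Rmult_le_compat_l; first exact: Cmod_ge_0.
  rewrite S_INR RtoC_plus.
  have -> : (s + (INR n + 1) = s + 1 + INR n)%C by ring.
  apply: Rle_trans (Cmod_triangle _ _) _; rewrite Cmod_R Rabs_pos_eq; lra.
have P_ge0 : 0 <= P := Cmod_ge_0 _.
have rP : r * P <= Q * (2 * INR n).
  by apply: Rle_trans PQ; apply: Rmult_le_compat_r.
set D := INR n`! * exp (Re s * ln (INR n)); have D_gt0 : 0 < D by apply: Rmult_lt_0_compat.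
rewrite -Rmult_assoc -/D.
have -> : P / (D * INR n) = r * P * / (r * D * INR n) by field; lra.
have -> : 2 / r * (Q / D) = Q * (2 * INR n) * / (r * D * INR n) by field; lra.
apply: Rmult_le_compat_r => //; apply/Rlt_le/Rinv_0_lt_compat.
by repeat apply: Rmult_lt_0_compat.
Qed.

(** The rate [lambda] is arbitrary.  Far enough to the right, moving [s] one step
    to the right divides the approximation by at least [exp lambda]; by induction
    on unit strips everything reduces to a bounded segment of the line
    [Im s = tau], where the uniform bound applies. *)
Lemma rGamma_approx_decay (beta tau lambda : R) :
  exists2 K, 0 <= K & forall s, beta <= Re s -> Im s = tau ->
    eventually (fun n => Cmod (rGamma_approx s n) <= K * exp (- lambda * Re s)).
Proof.
(* Beyond A, the point s - 1 is still right of beta and Re (s - 1) >= 2 exp lambda. *)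
pose A := Rmax (beta + 1) (1 + 2 * exp lambda).
have A_beta : beta + 1 <= A by exact: Rmax_l.
have A_lambda : 1 + 2 * exp lambda <= A by exact: Rmax_r.
(* M bounds |s| on the segment beta <= Re s <= A of the line. *)
pose M := Rabs beta + Rabs A + Rabs tau.
have M_ge0 : 0 <= M.
  by have := Rabs_pos beta; have := Rabs_pos A; have := Rabs_pos tau; rewrite /M; lra.
pose K := M * (M + 1) * exp (M + M ^ 2) * exp (Rabs lambda * M).
have K_ge0 : 0 <= K.
  have e1 := exp_pos (M + M ^ 2); have e2 := exp_pos (Rabs lambda * M).
  by apply: Rmult_le_pos; [apply: Rmult_le_pos; [nra|lra] | lra].
exists K => //.
have strip j : forall s, beta <= Re s <= A + INR j -> Im s = tau ->
    eventually (fun n => Cmod (rGamma_approx s n) <= K * exp (- lambda * Re s)).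
  elim: j => [|j IH] s [s_ge s_le] s_im.
    rewrite /= Rplus_0_r in s_le.
    have re_le : Rabs (Re s) <= Rabs beta + Rabs A.
      move: s_ge s_le; rewrite /Rabs; do 3 case: Rcase_abs => ?; lra.
    have mod_le : Cmod s <= M.
      by apply: Rle_trans (Cmod_le_abs s) _; rewrite s_im /M; lra.
    exists 1%N => n /leP n_gt0.
    apply: Rle_trans (rGamma_approx_bounded s M n mod_le n_gt0) _.
    rewrite /K [X in _ <= X]Rmult_assoc -exp_plus -[X in X <= _]Rmult_1_r.
    apply: Rmult_le_compat_l.
      by have := exp_pos (M + M ^ 2); nra.
    rewrite -exp_0; apply: exp_le.
    have : lambda * Re s <= Rabs lambda * M.
      apply: Rle_trans (Rle_abs _) _; rewrite Rabs_mult.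
      by apply: Rmult_le_compat_l; [exact: Rabs_pos | have := Rabs_pos tau; rewrite /M; lra].
    lra.
  have [s_small|s_large] := Rle_dec (Re s) (A + INR j); first exact: IH.
  have j_ge0 := pos_INR j.
  rewrite S_INR in s_le.
  pose s' := (s - 1)%C.
  have sE : s = (s' + 1)%C by rewrite /s'; ring.
  have re' : Re s' = Re s - 1 by rewrite /s'; case: (s).
  have im' : Im s' = tau by rewrite -s_im /s'; case: (s) => u v /=; ring.
  have bd' := IH s' _ im'.
  have {}bd' := bd' ltac:(lra).
  have e_gt0 := exp_pos lambda.
  have sh := rGamma_approx_shift s' (2 * exp lambda) ltac:(lra) ltac:(lra).
  apply: filter_imp (filter_and _ _ bd' sh) => n [h1 h2].
  rewrite {1}sE; apply: Rle_trans h2 _.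
  have -> : - lambda * Re s = - lambda * Re s' + - lambda by rewrite re'; ring.
  rewrite exp_plus exp_Ropp.
  have -> : 2 / (2 * exp lambda) = / exp lambda by field; lra.
  rewrite -Rmult_assoc Rmult_comm; apply: Rmult_le_compat_r => //.
  exact/Rlt_le/Rinv_0_lt_compat.
move=> s s_ge s_im.
have [j j_gt] := INR_unbounded (Re s - A).
by apply: (strip j) => //; lra.
Qed.

(** An eventual bound passes to [Lim_seq] whether or not the sequence converges,
    so bounds on [rGamma] follow directly from those on its approximations. *)
Lemma Rabs_Lim_seq_le (u : nat -> R) K :
  eventually (fun n => Rabs (u n) <= K) -> Rabs (Lim_seq u) <= K.
Proof.
move=> u_le.
have lo : Rbar_le (- K) (Lim_seq u).
  rewrite -(Lim_seq_const (- K)); apply: Lim_seq_le_loc.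
  by apply: filter_imp u_le => n /Rabs_le_between; lra.
have hi : Rbar_le (Lim_seq u) K.
  rewrite -(Lim_seq_const K); apply: Lim_seq_le_loc.
  by apply: filter_imp u_le => n /Rabs_le_between; lra.
by apply/Rabs_le_between; case: (Lim_seq u) lo hi.
Qed.

Lemma Cmod_rGamma_le s K :
  eventually (fun n => Cmod (rGamma_approx s n) <= K) -> Cmod (rGamma s) <= 2 * K.
Proof.
move=> s_le; apply: Rle_trans (Cmod_le_abs _) _.
have re : Rabs (Re (rGamma s)) <= K.
  apply: Rabs_Lim_seq_le; apply: filter_imp s_le => n.
  exact/Rle_trans/re_le_Cmod.
have im : Rabs (Im (rGamma s)) <= K.
  apply: Rabs_Lim_seq_le; apply: filter_imp s_le => n.
  exact/Rle_trans/im_le_Cmod.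
lra.
Qed.

(** * Terms of the Mittag-Leffler series *)

(** The coefficients [w^m / Gamma (b + m x)], with [w = z^x]; along the multiples
    of [n] and up to signs they are the terms of [E_{n x, b} (- z^(n x))]. *)
Definition ml_coef (x : R) (b logz : C) (m : nat) : C :=
  (Cpow_log logz x ^ m * rGamma (b + INR m * x))%C.

(** [lambda] is chosen so that [|w| exp (- lambda x) = 1 / 4]. *)
Lemma ml_coef_le x b logz : 0 < x ->
  exists K, forall m, Cmod (ml_coef x b logz m) <= K * (/ 4) ^ m.
Proof.
move=> x_gt0; pose lambda := Re logz + ln 4 / x.
have [K K_ge0 K_le] := rGamma_approx_decay (Re b) (Im b) lambda.
exists (2 * (K * exp (- lambda * Re b))) => m.
have re : Re (b + INR m * x)%C = Re b + INR m * x by case: (b) => u v /=; ring.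
have im : Im (b + INR m * x)%C = Im b by case: (b) => u v /=; ring.
have m_ge0 := pos_INR m.
have := Cmod_rGamma_le _ _ (K_le (b + INR m * x)%C _ im).
rewrite re => /(_ ltac:(nra)) g_le.
rewrite /ml_coef Cmod_mult.
have -> : Cmod (Cpow_log logz x ^ m)%C = exp (INR m * (x * Re logz)).
  elim: m {re im m_ge0 g_le} => [|m IH]; first by rewrite Cmod_1 Rmult_0_l exp_0.
  rewrite Cpow_S Cmod_mult IH Cmod_Cexp -exp_plus S_INR.
  by congr exp; case: (logz) => u v /=; ring.
apply: Rle_trans (Rmult_le_compat_l _ _ _ (Rlt_le _ _ (exp_pos _)) g_le) _.
have -> : (/ 4) ^ m = exp (- (INR m * ln 4)).
  rewrite exp_Ropp pow_inv; congr (/ _).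
  by rewrite -Rpower_pow; [rewrite /Rpower | lra].
have -> : - lambda * (Re b + INR m * x) =
    - lambda * Re b + - (INR m * (x * Re logz)) + - (INR m * ln 4).
  by rewrite /lambda; field; lra.
rewrite !exp_plus [exp (- (INR m * (x * _)))]exp_Ropp.
right; field; exact/Rgt_not_eq/exp_pos.
Qed.

Lemma Cpow_log_nat logz x n :
  Cpow_log logz (INR n * x)%C = (Cpow_log logz x ^ n)%C.
Proof.
elim: n => [|n IH].
  rewrite /Cpow_log !Cmult_0_l /Cexp /= exp_0 cos_0 sin_0; congr (_, _); ring.
rewrite Cpow_S -IH /Cpow_log -CexpD S_INR RtoC_plus; congr Cexp; ring.
Qed.

Lemma ml_term (x : R) b logz n k :
  (Cpow (- Cpow_log logz (INR n * x)) k * rGamma (b + (INR n * x) * INR k))%C =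
  (RtoC ((-1) ^ k) * ml_coef x b logz (n * k))%C.
Proof.
rewrite /ml_coef mult_INR RtoC_mult Cpow_log_nat.
have -> : (INR n * INR k * x = INR n * x * INR k)%C by ring.
rewrite Cmult_assoc; congr (_ * _)%C.
have -> : (Cpow_log logz x ^ (n * k) = (Cpow_log logz x ^ n) ^ k)%C.
  by rewrite -Cpow_mult_r.
elim: k => [|k IH] /=; first by ring.
by rewrite IH RtoC_mult; ring.
Qed.

Lemma Re_RtoC_mult r u : Re (RtoC r * u)%C = r * Re u.
Proof. by case: u => a c /=; ring. Qed.

Lemma Im_RtoC_mult r u : Im (RtoC r * u)%C = r * Im u.
Proof. by case: u => a c /=; ring. Qed.

Lemma is_series_C (a : nat -> C) (l : C) :
  is_series (fun n => Re (a n)) (Re l) -> is_series (fun n => Im (a n)) (Im l) ->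
  is_series a l.
Proof.
move=> /filterlim_locally re /filterlim_locally im.
apply/filterlim_locally => eps.
apply: filter_imp (filter_and _ _ (re eps) (im eps)) => n.
have -> : sum_n (fun n => Re (a n)) n = Re (sum_n a n).
  by elim: n => [|n IH]; rewrite ?sum_O // !sum_Sn IH.
have -> // : sum_n (fun n => Im (a n)) n = Im (sum_n a n).
by elim: n => [|n IH]; rewrite ?sum_O // !sum_Sn IH.
Qed.

Theorem mainTheorem6 :
  forall (x : R) (b z logz : C),
    0 < x ->
    z <> RtoC 0 ->
    Cexp logz = z ->
    is_series
      (fun m : nat =>
         let n := m.+1 in
         (IZR (moebius n) *
            (mittag_leffler (INR n * x) b (- Cpow_log logz (INR n * x))
             - rGamma b))%C)
      (2 * Cpow_log logz (2 * x) * rGamma (b + (2 * x))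
       - Cpow_log logz x * rGamma (b + x))%C.
Proof.
move=> x b z logz x_gt0 _ _.
pose c := ml_coef x b logz.
have [K c_le] := ml_coef_le x b logz x_gt0.
have c0 : rGamma b = c 0%N.
  by rewrite /c /ml_coef /= Cmult_1_l Cmult_0_l Cplus_0_r.
have -> : (2 * Cpow_log logz (2 * x) * rGamma (b + (2 * x))
       - Cpow_log logz x * rGamma (b + x) = 2 * c 2%N - c 1%N)%C.
  rewrite /c /ml_coef -!Cpow_log_nat /= (_ : 1 + 1 = 2) ?Cmult_1_l //.
  by rewrite Cmult_assoc.
have ml n : mittag_leffler (INR n * x) b (- Cpow_log logz (INR n * x)) =
    (Series (fun k => (-1) ^ k * Re (c (n * k)%N)),
     Series (fun k => (-1) ^ k * Im (c (n * k)%N))).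
  by congr (_, _); apply: Series_ext => k; rewrite ml_term ?Re_RtoC_mult ?Im_RtoC_mult.
apply: is_series_C.
  have -> : Re (2 * c 2%N - c 1%N)%C = 2 * Re (c 2%N) - Re (c 1%N).
    by rewrite /= !(Rmult_0_l, Rminus_0_r).
  have re_le m : Rabs (Re (c m)) <= K * (/ 4) ^ m by exact: Rle_trans (re_le_Cmod _) (c_le m).
  apply: is_series_ext (moebius_alternating_series _ _ re_le) => m.
  by rewrite Re_RtoC_mult ml c0.
have -> : Im (2 * c 2%N - c 1%N)%C = 2 * Im (c 2%N) - Im (c 1%N).
  by rewrite /= !(Rmult_0_l, Rplus_0_r).
have im_le m : Rabs (Im (c m)) <= K * (/ 4) ^ m by exact: Rle_trans (im_le_Cmod _) (c_le m).
apply: is_series_ext (moebius_alternating_series _ _ im_le) => m.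
by rewrite Im_RtoC_mult ml c0.
Qed.
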